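(* Let $R$ be a maximal subring of a ring $T$ and let $R$ be a left Artinian ring. Assume that $(R:T)_lT=T$. Then ${}_RT$ and $((R:T)_l)_R$ are finitely generated. In particular, $T$ is a left Artinian ring. Moreover, either $J(R)=J(T)\cap R$ or the following hold: (1) $Q:=(R:T)\in Max(T)$. In particular, $J(T)\subseteq J(R)\cap (R:T)$. (2) $T(R:T)_r=T$. In particular, $T_R$ is finitely generated. (3) If $M$ and $N$ are distinct maximal ideals of $T$ and $M,N\neq Q$, then $M\cap R\neq N\cap R$. In particular, $Max(R)=\{(R:T)_l, (R:T)_r\}\cup\{P\cap R\mid P\in Max(T), P\neq Q\}$ and $|Max(R)|=|Max(T)|+1$.
   Context: All rings are associative and unital (not necessarily commutative), and subrings contain the identity of the big ring; ''ideal'' means two-sided ideal. A maximal subring $R$ of $T$ is a proper subring with no subring strictly between $R$ and $T$. Conductors: $(R:T)=\{x\in T: TxT\subseteq R\}$, $(R:T)_l=\{x\in T: Tx\subseteq R\}$, $(R:T)_r=\{x\in T: xT\subseteq R\}$; all are ideals of $R$. ${}_RT$ (resp. $T_R$) is $T$ as a left (resp. right) $R$-module, and $((R:T)_l)_R$ is $(R:T)_l$ as a right $R$-module. $Max$ denotes the set of maximal (two-sided) ideals and $J$ the Jacobson radical. *)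

(* Defs.v *)
From HB Require Import structures.
From mathcomp Require Import all_boot all_order all_algebra.
From mathcomp Require Import all_classical.

Set Implicit Arguments.
Unset Strict Implicit.
Unset Printing Implicit Defensive.

Import GRing.Theory.

Local Open Scope ring_scope.
Local Open Scope classical_set_scope.

(* A subring is a subset [R : set T] of an ambient ring [T], and every notion
   about the ring [R] (ideals, [Max], [J], Artinian) is relative to [R]; the
   ring [T] itself is [setT]. *)

Definition subring (T : pzRingType) (R : set T) : Prop :=
  GRing.subring_closed (mem R).

Definition maximal_subring (T : pzRingType) (R : set T) : Prop :=
  [/\ subring R, R <> setT &
      forall S : set T, subring S -> R `<=` S -> S = R \/ S = setT].

Definition left_ideal (T : pzRingType) (R I : set T) : Prop :=
  [/\ I `<=` R, GRing.zmod_closed (mem I) &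
      forall r x, R r -> I x -> I (r * x)].

Definition ideal (T : pzRingType) (R I : set T) : Prop :=
  left_ideal R I /\ forall r x, R r -> I x -> I (x * r).

Definition maximal_left_ideal (T : pzRingType) (R M : set T) : Prop :=
  [/\ left_ideal R M, M <> R &
      forall I, left_ideal R I -> M `<=` I -> I = M \/ I = R].

Definition maximal_ideal (T : pzRingType) (R M : set T) : Prop :=
  [/\ ideal R M, M <> R &
      forall I, ideal R I -> M `<=` I -> I = M \/ I = R].

Definition Max (T : pzRingType) (R : set T) : set (set T) :=
  [set M | maximal_ideal R M].

Definition jacobson (T : pzRingType) (R : set T) : set T :=
  R `&` \bigcap_(M in [set M | maximal_left_ideal R M]) M.

Definition left_artinian (T : pzRingType) (R : set T) : Prop :=
  forall I : nat -> set T,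
    (forall n, left_ideal R (I n)) -> (forall n, I n.+1 `<=` I n) ->
    exists n, forall m, (n <= m)%N -> I m = I n.

Definition conductor (T : pzRingType) (R : set T) : set T :=
  [set x | forall s t : T, R (s * x * t)].

Definition lconductor (T : pzRingType) (R : set T) : set T :=
  [set x | forall t : T, R (t * x)].

Definition rconductor (T : pzRingType) (R : set T) : set T :=
  [set x | forall t : T, R (x * t)].

(* The product AB consists of the finite sums of products [a * b]. *)
Definition setprod (T : pzRingType) (A B : set T) : set T :=
  [set x | exists (n : nat) (a b : 'I_n -> T),
     [/\ forall i, A (a i), forall i, B (b i) & x = \sum_(i < n) a i * b i]].

Definition fg_left_module (T : pzRingType) (R M : set T) : Prop :=
  exists (n : nat) (g : 'I_n -> T),
    M = [set \sum_(i < n) c i * g i | c in [set c | forall i, R (c i)]].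

Definition fg_right_module (T : pzRingType) (R M : set T) : Prop :=
  exists (n : nat) (g : 'I_n -> T),
    M = [set \sum_(i < n) g i * c i | c in [set c | forall i, R (c i)]].

(* Main.v *)
(* Write L, K, Q for the left, right and two-sided conductors and J for the
   Jacobson radical of T. Since 1 is a sum of products a_i t_i with a_i in L,
   the t_i generate T over R and the a_i generate L, so T is left Artinian.
   For an ideal I of T not inside R, maximality gives R + I = T, hence
   T = L T = L + I; for I = J this would force L = T, so J lies in Q.
   As T/J is semisimple, every left ideal containing J has a complement modulo
   J. A complement of an ideal I strictly above Q lies in L, hence in Q, so
   I = T; and a complement of L lies in K. Thus Q is maximal, K + L = R and
   T K = T. Since L K is contained in Q, a maximal ideal of R containing Q is L
   or K, and the others correspond to the maximal ideals of T other than Q.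
   In particular the second alternative of the theorem always holds. *)

Require Import Defs.
From HB Require Import structures.
From mathcomp Require Import all_boot all_order all_algebra.
From mathcomp Require Import all_classical.

Set Implicit Arguments.
Unset Strict Implicit.
Unset Printing Implicit Defensive.

Import GRing.Theory.

Local Open Scope ring_scope.
Local Open Scope classical_set_scope.
Local Open Scope card_scope.

(** * Additive subgroups and their sums *)

Lemma zmod_closedP (V : zmodType) (A : set V) :
  GRing.zmod_closed (mem A) <-> A 0 /\ forall x y, A x -> A y -> A (x - y).
Proof.
split=> -[A0 AB]; split.
- by move: A0; rewrite inE.
- by move=> x y Ax Ay; have := AB x y; rewrite !inE; apply.
- by rewrite inE.
- by move=> x y; rewrite !inE; apply: AB.
Qed.

Section AdditiveSubgroups.
Variables (V : zmodType) (A : set V).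
Hypothesis zA : GRing.zmod_closed (mem A).

Lemma zset0 : A 0. Proof. by case/zmod_closedP: zA. Qed.

Lemma zsetB x y : A x -> A y -> A (x - y).
Proof. by case/zmod_closedP: zA => _; apply. Qed.

Lemma zsetN x : A x -> A (- x).
Proof. by move=> Ax; rewrite -sub0r; apply: zsetB => //; apply: zset0. Qed.

Lemma zsetD x y : A x -> A y -> A (x + y).
Proof. by move=> Ax Ay; rewrite -[y]opprK; apply: zsetB => //; apply: zsetN. Qed.

Lemma zset_sum n (f : 'I_n -> V) : (forall i, A (f i)) -> A (\sum_i f i).
Proof. by move=> Af; elim/big_ind: _ => //; [exact: zset0 | exact: zsetD]. Qed.

Lemma zsetDr x y : A x -> A (x + y) -> A y.
Proof. by move=> Ax Axy; rewrite -(addKr x y) addrC; apply: zsetB. Qed.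

End AdditiveSubgroups.

Definition sumset (V : zmodType) (A B : set V) : set V :=
  [set a + b | a in A & b in B].

Lemma sumset_zmod_closed (V : zmodType) (A B : set V) :
  GRing.zmod_closed (mem A) -> GRing.zmod_closed (mem B) ->
  GRing.zmod_closed (mem (sumset A B)).
Proof.
move=> zA zB; apply/zmod_closedP; split.
  by exists 0; [exact: zset0 | exists 0; [exact: zset0 | rewrite addr0]].
move=> _ _ [a Aa [b Bb <-]] [a' Aa' [b' Bb' <-]].
exists (a - a'); first exact: zsetB.
by exists (b - b'); [exact: zsetB | rewrite opprD addrACA].
Qed.

Lemma subset_sumsetl (V : zmodType) (A B : set V) :
  GRing.zmod_closed (mem B) -> A `<=` sumset A B.
Proof.
by move=> zB a Aa; exists a => //; exists 0; [exact: zset0 | rewrite addr0].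
Qed.

Lemma subset_sumsetr (V : zmodType) (A B : set V) :
  GRing.zmod_closed (mem A) -> B `<=` sumset A B.
Proof.
by move=> zA b Bb; exists 0; [exact: zset0 | exists b => //; rewrite add0r].
Qed.

(** * Subrings, their one-sided and two-sided ideals, and chain conditions *)

Section Subrings.
Variables (T : pzRingType) (R : set T).
Hypothesis subR : subring R.

Lemma subring1 : R 1. Proof. by case: subR; rewrite inE. Qed.

Lemma subringM x y : R x -> R y -> R (x * y).
Proof. by case: subR => _ _ RM Rx Ry; have := RM x y; rewrite !inE; apply. Qed.

Lemma subring_zmod_closed : GRing.zmod_closed (mem R).
Proof.
case: subR => R1 RB _; split => //.
by rewrite -(subrr 1) RB.
Qed.

End Subrings.

Lemma subringP (T : pzRingType) (R : set T) : R 1 ->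
  (forall x y, R x -> R y -> R (x - y)) ->
  (forall x y, R x -> R y -> R (x * y)) -> subring R.
Proof.
move=> R1 RB RM; split; first by rewrite inE.
- by move=> x y; rewrite !inE; apply: RB.
- by move=> x y; rewrite !inE; apply: RM.
Qed.

Lemma subringT (T : pzRingType) : subring [set: T].
Proof. by apply: subringP. Qed.

Section Ideals.
Variables (T : pzRingType) (R : set T).
Hypothesis subR : subring R.
Implicit Types A B I M P : set T.

Lemma left_ideal_zmod A : left_ideal R A -> GRing.zmod_closed (mem A).
Proof. by case. Qed.

Lemma left_ideal_sub A : left_ideal R A -> A `<=` R.
Proof. by case. Qed.

Lemma left_idealM A r x : left_ideal R A -> R r -> A x -> A (r * x).
Proof. by case=> _ _; apply. Qed.

Lemma idealMr A x r : ideal R A -> A x -> R r -> A (x * r).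
Proof. by case=> _ AM Ax Rr; apply: AM. Qed.

Lemma left_ideal1 A : left_ideal R A -> A 1 -> A = R.
Proof.
move=> lA A1; rewrite eqEsubset; split; first exact: left_ideal_sub.
by move=> x Rx; rewrite -[x]mulr1; apply: left_idealM.
Qed.

Lemma maximal_left_ideal1 M : maximal_left_ideal R M -> ~ M 1.
Proof. by case=> lM MR _ M1; apply: MR; apply: left_ideal1. Qed.

Lemma maximal_ideal1 M : maximal_ideal R M -> ~ M 1.
Proof. by case=> -[lM _] MR _ M1; apply: MR; apply: left_ideal1. Qed.

Lemma left_ideal_sumset A B :
  left_ideal R A -> left_ideal R B -> left_ideal R (sumset A B).
Proof.
move=> lA lB; split.
- move=> _ [a Aa [b Bb <-]].
  by apply: (zsetD (subring_zmod_closed subR));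
    [exact: (left_ideal_sub lA) | exact: (left_ideal_sub lB)].
- by apply: sumset_zmod_closed; apply: left_ideal_zmod.
- move=> r _ Rr [a Aa [b Bb <-]]; exists (r * a); first exact: left_idealM.
  by exists (r * b); [exact: left_idealM | rewrite mulrDr].
Qed.

Lemma ideal_sumset A B : ideal R A -> ideal R B -> ideal R (sumset A B).
Proof.
move=> iA iB; split; first by apply: left_ideal_sumset; [case: iA|case: iB].
move=> r _ Rr [a Aa [b Bb <-]]; exists (a * r); first exact: idealMr.
by exists (b * r); [exact: idealMr | rewrite mulrDl].
Qed.

Lemma left_ideal_setI A B :
  left_ideal R A -> left_ideal R B -> left_ideal R (A `&` B).
Proof.
move=> lA lB; split.
- by move=> x [Ax _]; apply: left_ideal_sub Ax.
- apply/zmod_closedP; split.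
    by split; apply: zset0; apply: left_ideal_zmod.
  move=> x y [Ax Bx] [Ay By].
  by split; apply: zsetB => //; apply: left_ideal_zmod.
- by move=> r x Rr [Ax Bx]; split; apply: left_idealM.
Qed.

Lemma maximal_left_comax M A :
  maximal_left_ideal R M -> left_ideal R A -> ~ A `<=` M ->
  exists m a, [/\ M m, A a & m + a = 1].
Proof.
move=> [lM _ maxM] lA AM.
have [||E|E] := maxM (sumset M A).
- exact: left_ideal_sumset.
- by apply: subset_sumsetl; apply: left_ideal_zmod.
- by case: AM; rewrite -E; apply: subset_sumsetr; apply: left_ideal_zmod.
- have : R 1 by exact: subring1.
  by rewrite -{1}E => -[m Mm [a Aa ma]]; exists m, a.
Qed.

Lemma maximal_comax M A :
  maximal_ideal R M -> ideal R A -> ~ A `<=` M ->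
  exists m a, [/\ M m, A a & m + a = 1].
Proof.
move=> [iM _ maxM] iA AM; have [lM lA] := (iM.1, iA.1).
have [||E|E] := maxM (sumset M A).
- exact: ideal_sumset.
- by apply: subset_sumsetl; apply: left_ideal_zmod.
- by case: AM; rewrite -E; apply: subset_sumsetr; apply: left_ideal_zmod.
- have : R 1 by exact: subring1.
  by rewrite -{1}E => -[m Mm [a Aa ma]]; exists m, a.
Qed.

(** Maximal ideals are prime: if [A] is not inside [P], then [1 = p + a], and both terms of
    [b = p * b + a * b] lie in [P]. *)
Lemma maximal_ideal_prime P A B : maximal_ideal R P ->
  ideal R A -> left_ideal R B ->
  (forall a b, A a -> B b -> P (a * b)) -> A `<=` P \/ B `<=` P.
Proof.
move=> mP iA lB AB; case: (pselect (A `<=` P)) => [|AP]; first by left.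
right=> b Bb; have [p [a [Pp Aa pa]]] := maximal_comax mP iA AP.
have [iP _ _] := mP; rewrite -[b]mul1r -pa mulrDl.
apply: (zsetD (left_ideal_zmod iP.1)); last exact: AB.
by apply: idealMr => //; apply: left_ideal_sub Bb.
Qed.

Lemma maximal_ideal_inj P P' : maximal_ideal R P -> maximal_ideal R P' ->
  P `<=` P' -> P = P'.
Proof.
move=> [iP _ maxP] [iP' P'R _] PP'.
by have [->|] := maxP _ iP' PP'.
Qed.

Lemma proper_left_ideal_maximal A : left_ideal R A -> ~ A 1 ->
  exists2 M, maximal_left_ideal R M & A `<=` M.
Proof.
move=> lA A1.
pose F := [set X | X = set0 \/ [/\ left_ideal R X, A `<=` X & ~ X 1]].
have FA : F A by right; split.
have [|M [FM maxM]] := @Zorn_bigcup T F.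
  move=> G GF Gtot.
  case: (pselect (exists2 X, G X & X <> set0)) => [[X0 GX0 X00]|nX]; last first.
    left; rewrite -subset0 => x [X GX Xx].
    by apply: nX; exists X => // E; rewrite E in Xx.
  right; case: (GF _ GX0) => // -[lX0 AX0 _].
  have lG X x : G X -> X x -> left_ideal R X /\ ~ X 1.
    by move=> GX Xx; case: (GF _ GX) => [E|[] //]; rewrite E in Xx.
  split; last 1 first.
  - by move=> [X GX X1]; have [] := lG X 1 GX X1.
  - split.
    + by move=> x [X GX Xx]; have [lX _] := lG X x GX Xx; apply: left_ideal_sub Xx.
    + apply/zmod_closedP; split.
        by exists X0 => //; apply: zset0; apply: left_ideal_zmod.
      move=> x y [X GX Xx] [Y GY Yy].
      have [lX _] := lG X x GX Xx; have [lY _] := lG Y y GY Yy.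
      have [XY|YX] := Gtot X Y GX GY.
        by exists Y => //; apply: (zsetB (left_ideal_zmod lY)) => //; apply: XY.
      by exists X => //; apply: (zsetB (left_ideal_zmod lX)) => //; apply: YX.
    + move=> r x Rr [X GX Xx]; have [lX _] := lG X x GX Xx.
      by exists X => //; apply: left_idealM.
  - by move=> x Ax; exists X0 => //; apply: AX0.
case: FM => [M0|[lM AM M1]].
  exfalso; apply: (maxM A) => //; rewrite M0; split=> // /(_ 0).
  by apply; apply: zset0; apply: left_ideal_zmod.
exists M => //; split=> //; first by move=> E; apply: M1; rewrite E; apply: subring1.
move=> I lI MI; case: (pselect (I `<=` M)) => IM.
  by left; rewrite eqEsubset.
right; apply: left_ideal1 => //; apply: contrapT => I1.
by apply: (maxM I) => //; right; split=> //; apply: subset_trans MI.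
Qed.

Lemma jacobson_left_ideal : left_ideal R (jacobson R).
Proof.
split; first by move=> x [].
- apply/zmod_closedP; split.
    split; first exact: zset0 (subring_zmod_closed subR).
    by move=> M [lM _ _]; apply: zset0; apply: left_ideal_zmod.
  move=> x y [Rx Jx] [Ry Jy]; split.
    exact: zsetB (subring_zmod_closed subR) _ _ Rx Ry.
  move=> M mM; have [lM _ _] := mM.
  by apply: (zsetB (left_ideal_zmod lM)); [apply: Jx | apply: Jy].
- move=> r x Rr [Rx Jx]; split; first exact: subringM.
  by move=> M mM; have [lM _ _] := mM; apply: left_idealM => //; apply: Jx.
Qed.

Lemma left_artinian_minimal (F : set (set T)) : left_artinian R ->
  F `<=` left_ideal R -> F !=set0 ->
  exists2 C, F C & forall D, F D -> D `<=` C -> D = C.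
Proof.
move=> artR FR [I0 FI0]; apply: contrapT => nomin.
(* The condition [F X] is put under the existential so that [choice] yields a total function, which
   is then iterated from [I0]. *)
have next X : exists Y, F X -> [/\ F Y, Y `<=` X & Y <> X].
  apply: contrapT => nY; apply: nomin; exists X.
    by apply: contrapT => FX; apply: nY; exists X.
  by move=> D FD DX; apply: contrapT => DX'; apply: nY; exists D.
have [f fP] := choice next.
have FI n : F (iter n f I0) by elim: n => //= n /fP[].
have [n|n|n stab] := artR (fun n => iter n f I0); first exact: FR.
- by have [] := fP _ (FI n).
- have [_ _] := fP _ (FI n); apply.
  exact: stab n.+1 (leqnSn n).
Qed.

(** For an infinite sequence of distinct maximal ideals [P k], the chain of partial intersections
    [I n] becomes stationary. Then [I n] lies in [P n], and primeness puts some earlier [P k] inside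
    [P n], hence equal to it. *)
Lemma left_artinian_finite_Max : left_artinian R -> finite_set (Max R).
Proof.
move=> artR; apply: contrapT => /infiniteP/ppcard_leP[P].
have mP n : maximal_ideal R (P n) by apply: (@funS _ _ _ _ P).
have iP n : ideal R (P n) by case: (mP n).
pose I n := [set x | R x /\ forall k, (k < n)%N -> P k x].
have lI n : left_ideal R (I n).
  split; first by move=> x [].
  - apply/zmod_closedP; split.
      split; first exact: zset0 (subring_zmod_closed subR).
      by move=> k _; apply: zset0 (left_ideal_zmod (iP k).1).
    move=> x y [Rx Ix] [Ry Iy]; split.
      exact: zsetB (subring_zmod_closed subR) _ _ Rx Ry.
    by move=> k kn; apply: (zsetB (left_ideal_zmod (iP k).1)); auto.
  - move=> r x Rr [Rx Ix]; split; first exact: subringM.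
    by move=> k kn; apply: (left_idealM (iP k).1); auto.
(* Induction on [n]: products of [P n] by [I n] lie in [I n.+1], so primeness of [P m] leaves [P n]
   or [I n] inside [P m]. *)
have prime n m : I n `<=` P m -> exists2 k, (k < n)%N & P k `<=` P m.
  elim: n => [|n IH] ImP.
    by case: (maximal_ideal1 (mP m)); apply: ImP; split=> //; apply: subring1.
  have [x y Px [Ry Iy]||/IH[k kn]] := maximal_ideal_prime (mP m) (iP n) (lI n).
  - apply: ImP; split; first exact: subringM (left_ideal_sub (iP n).1 Px) Ry.
    move=> k; rewrite ltnS leq_eqVlt => /orP[/eqP->|kn].
      exact: idealMr (iP n) Px Ry.
    by apply: (left_idealM (iP k).1) (Iy k kn); apply: left_ideal_sub Px; case: (iP n).
  - by exists n.
  - by exists k => //; apply: ltnW.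
have [n|n stab] := artR I lI.
  by move=> x [Rx Ix]; split=> // k kn; apply: Ix; apply: ltnW.
have [|k kn PkP] := prime n n.
  by rewrite -(stab n.+1 (leqnSn n)) => x [_]; apply.
have /(@inj _ _ _ P) E := maximal_ideal_inj (mP k) (mP n) PkP.
by move: kn; rewrite E ?inE // ltnn.
Qed.

End Ideals.

(** * Finitely generated modules over a left Artinian ring *)

Section FinitelyGeneratedModules.
Variables (T : pzRingType) (R : set T).
Hypotheses (subR : subring R) (artR : left_artinian R).
Implicit Types A N : set T.

Definition left_submodule N : Prop :=
  GRing.zmod_closed (mem N) /\ forall r x, R r -> N x -> N (r * x).

Definition dcc_within A : Prop := forall N : nat -> set T,
  (forall k, left_submodule (N k)) -> (forall k, N k.+1 `<=` N k) ->
  (forall k, N k `<=` A) -> exists n, forall m, (n <= m)%N -> N m = N n.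

Lemma decreasing_sets (N : nat -> set T) : (forall k, N k.+1 `<=` N k) ->
  forall n m, (n <= m)%N -> N m `<=` N n.
Proof.
move=> dN n m /subnKC <-; elim: (m - n)%N => [|k IH]; first by rewrite addn0.
by rewrite addnS; apply: subset_trans IH.
Qed.

(* A chain [N k] below [A + R g] is controlled by the chain [N k `&` A] and by
   the left ideals of those [r] with [r * g] in [N k + A]. *)
Lemma dcc_within_add1 A g : left_submodule A -> dcc_within A ->
  dcc_within [set a + r * g | a in A & r in R].
Proof.
move=> [zA AM] dA N lN dN NA.
have zN k := (lN k).1.
have [||n1 stab1] := dA (fun k => N k `&` A) _ _ (fun k => @subIsetr _ _ _).
- move=> k; split.
    apply/zmod_closedP; split; first by split; apply: zset0.
    by move=> x y [Nx Ax] [Ny Ay]; split; apply: zsetB.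
  by move=> r x Rr [Nx Ax]; split; [apply: (lN k).2 | apply: AM].
- by move=> k x [Nx Ax]; split=> //; apply: dN.
pose I k := [set r | R r /\ exists2 a, A a & N k (a + r * g)].
have zR := subring_zmod_closed subR.
have [k|k|n2 stab2] := artR (I := I).
- split; first by move=> r [].
    apply/zmod_closedP; split.
      split; first exact: zset0.
      by exists 0; [exact: zset0 | rewrite mul0r addr0; exact: zset0].
    move=> x y [Rx [a Aa Na]] [Ry [b Ab Nb]]; split; first exact: zsetB.
    exists (a - b); first exact: zsetB.
    by rewrite mulrBl addrACA -opprD; apply: zsetB.
  move=> r x Rr [Rx [a Aa Na]]; split; first exact: subringM.
  exists (r * a); first exact: AM.
  by rewrite -mulrA -mulrDr; apply: (lN k).2.
- by move=> r [Rr [a Aa Na]]; split=> //; exists a => //; apply: dN.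
exists (maxn n1 n2) => m; rewrite geq_max => /andP[n1m n2m].
have n1M : (n1 <= maxn n1 n2)%N by rewrite leq_maxl.
have n2M : (n2 <= maxn n1 n2)%N by rewrite leq_maxr.
have MN : N m `<=` N (maxn n1 n2).
  by apply: decreasing_sets => //; rewrite geq_max n1m.
rewrite eqEsubset; split=> // x Nx.
have [a Aa [r Rr xE]] := NA _ _ Nx.
have : I (maxn n1 n2) r by split=> //; exists a => //; rewrite xE.
rewrite (stab2 _ n2M) -(stab2 _ n2m) => -[_ [a' Aa' Na']].
have : (N (maxn n1 n2) `&` A) (a - a').
  split; last exact: zsetB.
  have -> : a - a' = x - (a' + r * g) by rewrite -xE opprD addrACA subrr addr0.
  by apply: zsetB => //; apply: MN.
rewrite (stab1 _ n1M) -(stab1 _ n1m) => -[Naa' _].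
have -> : x = (a - a') + (a' + r * g) by rewrite addrA subrK.
exact: zsetD.
Qed.

Lemma span_left_submodule n (g : 'I_n -> T) :
  left_submodule [set \sum_(i < n) c i * g i | c in [set c | forall i, R (c i)]].
Proof.
have zR := subring_zmod_closed subR; split.
  apply/zmod_closedP; split.
    exists (fun=> 0); first by move=> i; apply: zset0.
    by rewrite big1 // => i _; rewrite mul0r.
  move=> _ _ [c Rc <-] [d Rd <-]; exists (fun i => c i - d i).
    by move=> i; apply: zsetB.
  by rewrite -sumrB; apply: eq_bigr => i _; rewrite mulrBl.
move=> r _ Rr [c Rc <-]; exists (fun i => r * c i).
  by move=> i; apply: subringM.
by rewrite mulr_sumr; apply: eq_bigr => i _; rewrite mulrA.
Qed.

Lemma dcc_within_span n (g : 'I_n -> T) :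
  dcc_within [set \sum_(i < n) c i * g i | c in [set c | forall i, R (c i)]].
Proof.
elim: n g => [|n IH] g.
  move=> N lN _ N0; exists 0%N => m _; rewrite eqEsubset.
  by split=> x /N0 [c _ <-]; rewrite big_ord0; apply: zset0; apply: (lN _).1.
move=> N lN dN Ng; pose g' i := g (widen_ord (leqnSn n) i).
apply: (dcc_within_add1 (span_left_submodule g') (IH g') (g := g ord_max)) => //.
move=> k x /Ng [c Rc <-]; rewrite big_ord_recr /=.
exists (\sum_(i < n) c (widen_ord (leqnSn n) i) * g' i).
  by exists (fun i => c (widen_ord (leqnSn n) i)) => // i; apply: Rc.
by exists (c ord_max) => //; apply: Rc.
Qed.

(** Left ideals of [T] are in particular left [R]-submodules of [T], which is spanned by the
    generators. *)
Lemma fg_left_artinian : fg_left_module R setT -> left_artinian [set: T].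
Proof.
move=> [n [g gE]] I lI dI; apply: (dcc_within_span (g := g)) => //.
  by move=> k; case: (lI k) => _ zI IM; split=> // r x _; apply: IM.
by move=> k x _; rewrite -gE.
Qed.

End FinitelyGeneratedModules.

(** * The Jacobson radical of [T] and complements modulo it *)

Section Jacobson.
Variable T : pzRingType.
Implicit Types A B C I M P Q : set T.

Local Notation J := (jacobson [set: T]).

Lemma left_idealTP A : left_ideal [set: T] A <->
  GRing.zmod_closed (mem A) /\ forall t x, A x -> A (t * x).
Proof.
split=> [[_ zA AM]|[zA AM]]; first by split=> // t x; apply: AM.
by split=> // r x _; apply: AM.
Qed.

Lemma left_idealTM A t x : left_ideal [set: T] A -> A x -> A (t * x).
Proof. by case/left_idealTP => _; apply. Qed.

Lemma jacobsonT_left_ideal : left_ideal [set: T] J.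
Proof. exact: jacobson_left_ideal (subringT T). Qed.

Lemma jacobson_sub_maximal M x :
  maximal_left_ideal [set: T] M -> J x -> M x.
Proof. by move=> mM [_]; apply. Qed.

(** The radical is an intersection of left ideals, so only right multiplication needs an argument.
    If a maximal left ideal [M] misses [x * t], then [N], the set of [y] with [y * t] in [M], is
    again a maximal left ideal, so it contains [x]. *)
Lemma jacobson_ideal : ideal [set: T] J.
Proof.
have lJ := jacobsonT_left_ideal.
split=> // t x _ Jx; split=> // M mM; apply: contrapT => Mxt.
have [lM MT maxM] := mM; have zM := left_ideal_zmod lM.
pose N := [set y | M (y * t)].
have lN : left_ideal [set: T] N.
  apply/left_idealTP; split.
    apply/zmod_closedP; split; first by rewrite /N /= mul0r; apply: zset0.
    by move=> y z My Mz; rewrite /N /= mulrBl; apply: zsetB.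
  by move=> s y My; rewrite /N /= -mulrA; apply: left_idealTM.
apply: (Mxt); apply: (@jacobson_sub_maximal N) => //; split => //.
  by move=> NT; apply: Mxt; change (N x); rewrite NT.
move=> I lI NI; case: (pselect (I `<=` N)) => IN.
  by left; rewrite eqEsubset.
right; apply: left_ideal1 => //.
have lIt : left_ideal [set: T] [set y * t | y in I].
  apply/left_idealTP; split.
    apply/zmod_closedP; split.
      by exists 0; [exact: zset0 (left_ideal_zmod lI) | rewrite mul0r].
    move=> _ _ [y Iy <-] [z Iz <-]; exists (y - z); last by rewrite mulrBl.
    exact: zsetB (left_ideal_zmod lI) _ _ Iy Iz.
  move=> s _ [y Iy <-]; exists (s * y); last by rewrite mulrA.
  exact: left_idealTM.
have [|m [_ [Mm [y Iy <-] my1]]] := maximal_left_comax (subringT T) mM lIt.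
  by move=> ItM; apply: IN => y Iy; apply: ItM; exists y.
(* From [m + y * t = 1] one gets [(1 - t * y) * t = t * m], which is in [M]. Since also [t * y] is
   in [I], this puts [1] in [I]. *)
have : N (1 - t * y).
  rewrite /N /= mulrBl mul1r.
  have -> : t - t * y * t = t * m.
    by apply: (addIr (t * y * t)); rewrite subrK -mulrA -mulrDr my1 mulr1.
  exact: left_idealTM.
move=> /NI I1; rewrite -(subrK (t * y) 1).
by apply: (zsetD (left_ideal_zmod lI)) => //; apply: left_idealTM.
Qed.

(** Otherwise the left ideal generated by [1 - x] lies in a maximal left ideal, which also contains
    [x], hence [1]. *)
Lemma jacobson_left_inverse x : J x -> exists u, u * (1 - x) = 1.
Proof.
move=> Jx; apply: contrapT => nu.
pose A := [set u * (1 - x) | u in [set: T]].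
have [||M mM AM] := @proper_left_ideal_maximal T setT (subringT T) A.
- apply/left_idealTP; split; last first.
    by move=> t _ [u _ <-]; exists (t * u); rewrite // mulrA.
  apply/zmod_closedP; split; first by exists 0; rewrite // mul0r.
  by move=> _ _ [u _ <-] [v _ <-]; exists (u - v); rewrite // mulrBl.
- by move=> [u _ u1]; apply: nu; exists u.
apply: (maximal_left_ideal1 mM); rewrite -(subrK x 1).
have [lM _ _] := mM; apply: (zsetD (left_ideal_zmod lM)).
  by apply: AM; exists 1; rewrite // mul1r.
exact: jacobson_sub_maximal.
Qed.

(** If a maximal left ideal [M] of [R] misses a point of [J], then [m + y = 1] with [m] in [M] and
    [y] in [J]. The left inverse [u] of [m = 1 - y] satisfies [u = 1 + u * y], so it lies in [R] and
    [M] contains [1]. *)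
Lemma sub_jacobson (R : set T) : subring R -> J `<=` R -> J `<=` jacobson R.
Proof.
move=> subR JR x Jx; split; first exact: JR.
move=> M mM; apply: contrapT => Mx; have [lM _ _] := mM.
have lJ := jacobsonT_left_ideal.
have lJR : left_ideal R J.
  by split=> //; [case: lJ | move=> r y _; apply: left_idealTM].
have [|m [y [Mm Jy my]]] := maximal_left_comax subR mM lJR.
  by move/(_ _ Jx).
have [u u1] := jacobson_left_inverse Jy.
have uE : u = 1 + u * y by rewrite -{1}u1 mulrBr mulr1 subrK.
have Ru : R u.
  rewrite uE; apply: (zsetD (subring_zmod_closed subR)); first exact: subring1.
  by apply: JR; apply: left_idealTM.
have mE : m = 1 - y by rewrite -my addrK.
by apply: (maximal_left_ideal1 mM); rewrite -u1 -mE; apply: (left_idealM lM).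
Qed.

(** A form of Nakayama's lemma: a maximal left ideal above a proper [A] would contain both [a] and
    [j]. *)
Lemma left_ideal_jacobson_comax A : left_ideal [set: T] A ->
  (exists a j, [/\ A a, J j & a + j = 1]) -> A 1.
Proof.
move=> lA [a [j [Aa Jj aj]]]; apply: contrapT => A1.
have [M mM AM] := proper_left_ideal_maximal (subringT T) lA A1.
have [lM _ _] := mM; apply: (maximal_left_ideal1 mM); rewrite -aj.
apply: (zsetD (left_ideal_zmod lM)); first exact: AM.
exact: jacobson_sub_maximal.
Qed.

(** Semiprimeness of [J]: if a maximal left ideal [M] misses [x], then [m + a = 1] and
    [x = x * m + x * a] lies in [M] after all. *)
Lemma square_sub_jacobson A : left_ideal [set: T] A ->
  (forall a b, A a -> A b -> J (a * b)) -> A `<=` J.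
Proof.
move=> lA AA x Ax; split=> // M mM; apply: contrapT => Mx; have [lM _ _] := mM.
have [|m [a [Mm Aa ma]]] := maximal_left_comax (subringT T) mM lA.
  by move/(_ _ Ax).
apply: Mx; rewrite -[x]mulr1 -ma mulrDr.
apply: (zsetD (left_ideal_zmod lM)); first exact: left_idealTM.
by apply: jacobson_sub_maximal => //; apply: AA.
Qed.

(* [C] is minimal among the left ideals with [C + A = T]: cutting it down by a
   maximal left ideal missing a point of [C `&` A] would contradict this. *)
Lemma jacobson_complement A : left_artinian [set: T] ->
  left_ideal [set: T] A -> J `<=` A ->
  exists C, [/\ left_ideal [set: T] C, J `<=` C, C `&` A `<=` J &
                exists c a, [/\ C c, A a & c + a = 1]].
Proof.
move=> artT lA JA.
pose F := [set C | [/\ left_ideal [set: T] C, J `<=` C &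
                    exists c a, [/\ C c, A a & c + a = 1]]].
have zA := left_ideal_zmod lA.
have [||C [lC JC [c [a [Cc Aa ca]]]] minC] := left_artinian_minimal artT (F := F).
- by move=> C [].
- exists setT; split=> //; first by apply/left_idealTP; split=> //; apply/zmod_closedP.
  by exists 1, 0; split=> //; [apply: zset0 | rewrite addr0].
have zC := left_ideal_zmod lC.
exists C; split=> //; last by exists c, a.
move=> x [Cx Ax]; split=> // M mM; apply: contrapT => Mx; have [lM _ _] := mM.
pose X := [set t * x | t in [set: T]].
have lX : left_ideal [set: T] X.
  apply/left_idealTP; split; last first.
    by move=> t _ [u _ <-]; exists (t * u); rewrite // mulrA.
  apply/zmod_closedP; split; first by exists 0; rewrite // mul0r.
  by move=> _ _ [u _ <-] [v _ <-]; exists (u - v); rewrite // mulrBl.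
have [|m [_ [Mm [t _ <-] mt]]] := maximal_left_comax (subringT T) mM lX.
  by move=> XM; apply: Mx; apply: XM; exists 1; rewrite // mul1r.
suff CM : C `&` M = C by apply: Mx; move: Cx; rewrite -CM => -[].
apply: minC; last exact: subIsetl.
split; first exact: left_ideal_setI.
  by move=> y Jy; split; [exact: JC | exact: jacobson_sub_maximal].
exists (c * m), (c * t * x + a); split.
- split; last exact: left_idealTM.
  have -> : c * m = c - c * t * x.
    by apply: (addIr (c * t * x)); rewrite subrK -mulrA -mulrDr mt mulr1.
  by apply: zsetB => //; apply: left_idealTM.
- by apply: zsetD => //; apply: left_idealTM.
- by rewrite addrA -mulrA -mulrDr mt mulr1.
Qed.

End Jacobson.

(** * Products of subsets *)

Lemma setprod_sub (T : pzRingType) (A B X : set T) :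
  GRing.zmod_closed (mem X) -> (forall a b, A a -> B b -> X (a * b)) ->
  setprod A B `<=` X.
Proof.
move=> zX AB _ [n [a [b [Aa Bb ->]]]].
by apply: zset_sum => // i; apply: AB.
Qed.

Lemma setprodM (T : pzRingType) (A B : set T) a b :
  A a -> B b -> setprod A B (a * b).
Proof.
by move=> Aa Bb; exists 1%N, (fun=> a), (fun=> b); rewrite big_ord1.
Qed.

Lemma setprod_ideal (T : pzRingType) (A B : set T) :
  (forall t x, A x -> A (t * x)) -> (forall x t, B x -> B (x * t)) ->
  ideal [set: T] (setprod A B).
Proof.
move=> AM BM; split; last first.
  move=> t _ _ [n [a [b [Aa Bb ->]]]]; exists n, a, (fun i => b i * t).
  split=> // [i|]; first exact: BM.
  by rewrite mulr_suml; apply: eq_bigr => i _; rewrite mulrA.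
apply/left_idealTP; split; last first.
  move=> t _ [n [a [b [Aa Bb ->]]]]; exists n, (fun i => t * a i), b.
  split=> // [i|]; first exact: AM.
  by rewrite mulr_sumr; apply: eq_bigr => i _; rewrite mulrA.
apply/zmod_closedP; split.
  by exists 0%N, (fun=> 0), (fun=> 0); split; [case|case|rewrite big_ord0].
move=> _ _ [n [a [b [Aa Bb ->]]]] [m [c [d [Ac Bd ->]]]].
exists (n + m)%N.
(* [A] is not assumed closed under opposites, so the subtracted terms are negated by a left
   multiplication by [-1]. *)
exists (fun i : 'I_(n + m) =>
  match fintype.split i with inl j => a j | inr j => -1 * c j end).
exists (fun i : 'I_(n + m) =>
  match fintype.split i with inl j => b j | inr j => d j end); split.
- by move=> i; case: (fintype.split i) => // j; apply: AM.
- by move=> i; case: (fintype.split i).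
rewrite big_split_ord /= -sumrN; congr (_ + _); apply: eq_bigr => i _.
  by rewrite (unsplitK (inl i)).
by rewrite (unsplitK (inr i)) mulN1r mulNr.
Qed.

(** * Conductors as ideals, and the finite generation they provide *)

Section Conductors.
Variables (T : pzRingType) (R : set T).
Hypothesis subR : subring R.

Local Notation L := (lconductor R).
Local Notation K := (rconductor R).
Local Notation Q := (conductor R).

Let zR : GRing.zmod_closed (mem R) := subring_zmod_closed subR.

Lemma lconductor_sub : L `<=` R.
Proof. by move=> x /(_ 1); rewrite mul1r. Qed.

Lemma rconductor_sub : K `<=` R.
Proof. by move=> x /(_ 1); rewrite mulr1. Qed.

Lemma conductor_subl : Q `<=` L.
Proof. by move=> x Qx t; have := Qx t 1; rewrite mulr1. Qed.

Lemma conductor_subr : Q `<=` K.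
Proof. by move=> x Qx t; have := Qx 1 t; rewrite mul1r. Qed.

Lemma conductor_sub : Q `<=` R.
Proof. exact: subset_trans conductor_subl lconductor_sub. Qed.

Lemma lconductor_zmod : GRing.zmod_closed (mem L).
Proof.
apply/zmod_closedP; split; first by move=> t; rewrite mulr0; apply: zset0.
by move=> x y Lx Ly t; rewrite mulrBr; apply: zsetB.
Qed.

Lemma rconductor_zmod : GRing.zmod_closed (mem K).
Proof.
apply/zmod_closedP; split; first by move=> t; rewrite mul0r; apply: zset0.
by move=> x y Lx Ly t; rewrite mulrBl; apply: zsetB.
Qed.

Lemma lconductorMl t x : L x -> L (t * x).
Proof. by move=> Lx s; rewrite mulrA; apply: Lx. Qed.

Lemma rconductorMr x t : K x -> K (x * t).
Proof. by move=> Kx s; rewrite -mulrA; apply: Kx. Qed.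

Lemma lconductorMr x r : L x -> R r -> L (x * r).
Proof. by move=> Lx Rr t; rewrite mulrA; apply: subringM. Qed.

Lemma rconductorMl r x : R r -> K x -> K (r * x).
Proof. by move=> Rr Kx t; rewrite -mulrA; apply: subringM. Qed.

Lemma lconductor_left_ideal : left_ideal [set: T] L.
Proof.
by apply/left_idealTP; split; [exact: lconductor_zmod | exact: lconductorMl].
Qed.

Lemma lconductor_ideal : ideal R L.
Proof.
split; last by move=> r x Rr Lx; apply: lconductorMr.
split; [exact: lconductor_sub | exact: lconductor_zmod |].
by move=> r x _; apply: lconductorMl.
Qed.

Lemma rconductor_ideal : ideal R K.
Proof.
split; last by move=> r x _; apply: rconductorMr.
split; [exact: rconductor_sub | exact: rconductor_zmod |].
by move=> r x; apply: rconductorMl.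
Qed.

Lemma conductorMl t x : Q x -> Q (t * x).
Proof. by move=> Qx s u; rewrite mulrA; apply: Qx. Qed.

Lemma conductorMr x t : Q x -> Q (x * t).
Proof. by move=> Qx s u; rewrite mulrA -mulrA; apply: Qx. Qed.

Lemma conductor_zmod : GRing.zmod_closed (mem Q).
Proof.
apply/zmod_closedP; split.
  by move=> s t; rewrite mulr0 mul0r; apply: zset0.
by move=> x y Qx Qy s t; rewrite mulrBr mulrBl; apply: zsetB.
Qed.

Lemma conductor_idealT : ideal [set: T] Q.
Proof.
split; last by move=> t x _; apply: conductorMr.
by apply/left_idealTP; split; [exact: conductor_zmod | exact: conductorMl].
Qed.

Lemma conductor_ideal : ideal R Q.
Proof.
split; last by move=> r x _; apply: conductorMr.
split; [exact: conductor_sub | exact: conductor_zmod |].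
by move=> r x _; apply: conductorMl.
Qed.

(** Regroup [s * (x * y) * t] as [(s * x) * (y * t)], a product of two elements of [R]. *)
Lemma lrconductorM x y : L x -> K y -> Q (x * y).
Proof.
move=> Lx Ky s t; rewrite mulrA -mulrA; apply: subringM => //.
Qed.

Lemma ideal_sub_conductor I : ideal [set: T] I -> I `<=` R -> I `<=` Q.
Proof.
move=> iI IR x Ix s t; apply: IR; apply: (idealMr iI) => //.
by apply: left_idealTM iI.1 _.
Qed.

(** Writing [1] as the sum of the [a i * b i], the coefficient of [b i] in [t] is [t * a i], which
    lies in [R] because [a i] is in [L]. *)
Lemma fg_left_module_lconductor : setprod L setT = setT -> fg_left_module R setT.
Proof.
move=> lT; have [n [a [b [La _ ab]]]] : setprod L setT 1 by rewrite lT.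
exists n, b; rewrite eqEsubset; split=> // t _.
exists (fun i => t * a i); first by move=> i; apply: La.
by rewrite -[RHS]mulr1 ab mulr_sumr; apply: eq_bigr => i _; rewrite mulrA.
Qed.

Lemma fg_right_module_lconductor : setprod L setT = setT -> fg_right_module R L.
Proof.
move=> lT; have [n [a [b [La _ ab]]]] : setprod L setT 1 by rewrite lT.
exists n, a; rewrite eqEsubset; split=> [x Lx|_ [c Rc <-]].
  exists (fun i => b i * x); first by move=> i; apply: Lx.
  by rewrite -[RHS]mul1r ab mulr_suml; apply: eq_bigr => i _; rewrite mulrA.
by apply: (zset_sum lconductor_zmod) => i; apply: lconductorMr.
Qed.

Lemma fg_right_module_rconductor : setprod setT K = setT -> fg_right_module R setT.
Proof.
move=> rT; have [n [a [b [_ Kb ab]]]] : setprod setT K 1 by rewrite rT.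
exists n, a; rewrite eqEsubset; split=> // t _.
exists (fun i => b i * t); first by move=> i; apply: Kb.
by rewrite -[RHS]mul1r ab mulr_suml; apply: eq_bigr => i _; rewrite mulrA.
Qed.

End Conductors.

(** * Conductors of a maximal subring of a left Artinian ring *)

Section MaximalSubring.
Variables (T : pzRingType) (R : set T).
Hypotheses (R_max : maximal_subring R) (artT : left_artinian [set: T]).

Local Notation L := (lconductor R).
Local Notation K := (rconductor R).
Local Notation Q := (conductor R).
Local Notation J := (jacobson [set: T]).

Hypothesis lT : setprod L setT = setT.

Let subR : subring R. Proof. by case: R_max. Qed.
Let subT : subring [set: T] := subringT T.
Let zL : GRing.zmod_closed (mem L) := lconductor_zmod subR.
Let zK : GRing.zmod_closed (mem K) := rconductor_zmod subR.

Lemma maximal_subring_proper : ~ (forall x, R x).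
Proof.
by move=> RT; case: R_max => _ + _; apply; rewrite eqEsubset; split=> // x _.
Qed.

Lemma lconductor1 : ~ L 1.
Proof.
by move=> L1; apply: maximal_subring_proper => t; rewrite -[t]mulr1; apply: L1.
Qed.

Lemma rconductor1 : ~ K 1.
Proof.
by move=> K1; apply: maximal_subring_proper => t; rewrite -[t]mul1r; apply: K1.
Qed.

Lemma maximal_subring_adjoin (S : set T) :
  subring S -> R `<=` S -> S <> setT -> S = R.
Proof. by case: R_max => _ _ maxR subS RS ST; have [|] := maxR S subS RS. Qed.

Lemma maximal_subring_ideal I : ideal [set: T] I -> ~ I `<=` R ->
  sumset R I = setT.
Proof.
move=> iI IR; have zI := left_ideal_zmod iI.1.
have zR := subring_zmod_closed subR; have zRI := sumset_zmod_closed zR zI.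
apply: contrapT => RIT; apply: IR.
rewrite -(maximal_subring_adjoin _ _ RIT); first exact: subset_sumsetr.
- apply: subringP; [exact: subset_sumsetl (subring1 subR)|exact: zsetB|].
  move=> _ _ [r Rr [x Ix <-]] [s Rs [y Iy <-]].
  exists (r * s); first exact: subringM.
  (* The part of [(r + x) * (s + y)] other than [r * s]; it lies in [I]. *)
  exists (r * y + x * (s + y)); last by rewrite mulrDl !mulrDr addrA.
  apply: zsetD => //; first exact: left_idealTM iI.1 _.
  exact: idealMr iI _ _.
- exact: subset_sumsetl.
Qed.

(* Any [I] adjoined to [R] can be adjoined to [L] instead, since [T = L T]. *)
Lemma lconductor_comax I : ideal [set: T] I -> ~ I `<=` R ->
  exists l i, [/\ L l, I i & l + i = 1].
Proof.
move=> iI IR; have zI := left_ideal_zmod iI.1.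
have : setprod L setT 1 by rewrite lT.
have LI : setprod L setT `<=` sumset L I.
  apply: setprod_sub => [|a t La _]; first exact: sumset_zmod_closed.
  have : sumset R I t by rewrite maximal_subring_ideal.
  move=> [r Rr [i Ii <-]]; exists (a * r); first exact: lconductorMr.
  by exists (a * i); [exact: left_idealTM iI.1 _ | rewrite mulrDr].
by move=> /LI [l Ll [i Ii li]]; exists l, i.
Qed.

Lemma jacobson_sub_conductor : J `<=` Q.
Proof.
apply: ideal_sub_conductor; first exact: jacobson_ideal.
apply: contrapT => JR; apply: lconductor1.
apply: left_ideal_jacobson_comax; first exact: lconductor_left_ideal.
exact: (lconductor_comax (jacobson_ideal T)).
Qed.

Lemma conductor_maximal : maximal_ideal [set: T] Q.
Proof.
split; first exact: conductor_idealT.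
  move=> QT; apply: lconductor1; apply: conductor_subl.
  by rewrite QT.
move=> I iI QI; case: (pselect (I `<=` R)) => IR.
  by left; rewrite eqEsubset; split=> //; apply: ideal_sub_conductor.
right; have lI := iI.1; have zI := left_ideal_zmod lI.
have JI : J `<=` I := subset_trans jacobson_sub_conductor QI.
have [C [lC JC CI [c [i [Cc Ii ci]]]]] := jacobson_complement artT lI JI.
have lJ := jacobsonT_left_ideal T; have zJ := left_ideal_zmod lJ.
have zC := left_ideal_zmod lC.
have JIC x y : I x -> C y -> J (x * y).
  move=> Ix Cy; apply: CI; split; first exact: left_idealTM.
  exact: idealMr iI Ix _.
(* The ideal [C I] has square [C (I C) I], which lies in [J] since [I C] does. Semiprimeness of [J]
   then puts [C I] itself in [J]. *)
have JCI x y : C x -> I y -> J (x * y).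
  move=> Cx Iy; pose A := setprod C I.
  have iA : ideal [set: T] A.
    apply: setprod_ideal; first by move=> t z; apply: left_idealTM.
    by move=> z t Iz; apply: (idealMr iI).
  apply: (square_sub_jacobson (A := A) iA.1); last exact: setprodM.
  move=> a b Aa Ab; move: Aa.
  apply: (@setprod_sub _ _ _ [set a | J (a * b)]).
    apply/zmod_closedP; split; first by rewrite /= mul0r; apply: zset0.
    by move=> u v Ju Jv; rewrite /= mulrBl; apply: zsetB.
  move=> u v Cu Iv /=; move: Ab.
  apply: (@setprod_sub _ _ _ [set b | J (u * v * b)]).
    apply/zmod_closedP; split; first by rewrite /= mulr0; apply: zset0.
    by move=> w z Jw Jz; rewrite /= mulrBr; apply: zsetB.
  move=> w z Cw Iz /=; rewrite -mulrA; apply: (left_idealTM _ lJ).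
  rewrite mulrA; apply: (idealMr (jacobson_ideal T)) => //.
  exact: JIC.
(* With [l + j = 1], [l] in [L] and [j] in [I], the term [x * j] of [x = x * l + x * j] lies in
   [C I], hence in [J], [Q] and [L]. *)
have CL : C `<=` L.
  have [l [j [Ll Ij lj]]] := lconductor_comax iI IR.
  move=> x Cx; rewrite -[x]mulr1 -lj mulrDr; apply: (zsetD zL).
    exact: lconductorMl.
  by apply: conductor_subl; apply: jacobson_sub_conductor; apply: JCI.
(* Split [t = t * c + t * i]: [x * t * c] is in the left ideal [C], and [x * t * i] is in [C I],
   hence in [J] and in [C]. *)
have iC : ideal [set: T] C.
  split=> // t x _ Cx; rewrite -[t]mulr1 -ci mulrDr mulrDr.
  apply: zsetD => //.
    by rewrite mulrA; apply: left_idealTM.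
  rewrite mulrA; apply: JC.
  rewrite -mulrA; apply: JCI => //; exact: left_idealTM.
apply: left_ideal1 => //; rewrite -ci; apply: zsetD => //; apply: QI.
apply: (ideal_sub_conductor iC) => //.
exact: subset_trans CL (@lconductor_sub _ R).
Qed.

(** The right multipliers preserving [L] form a subring containing [R]. It is not [T], since
    [L T = T] would then give [L = T], so by maximality it is [R]. *)
Lemma lconductor_idealizer x : (forall a, L a -> L (a * x)) -> R x.
Proof.
move=> Lx; pose S := [set t | forall a, L a -> L (a * t)].
suff <- : S = R by [].
apply: maximal_subring_adjoin.
- apply: subringP; first by move=> a La; rewrite mulr1.
    by move=> u v Su Sv a La; rewrite mulrBr; apply: (zsetB zL); [exact: Su|exact: Sv].
  by move=> u v Su Sv a La; rewrite mulrA; apply: Sv; apply: Su.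
- by move=> r Rr a La; apply: lconductorMr.
- move=> ST; apply: lconductor1.
  have : setprod L setT 1 by rewrite lT.
  apply: (setprod_sub (X := L) zL) => a t La _.
  by have : S t by [rewrite ST]; apply.
Qed.

(** Let [c] be the component of [1] in a complement [C] of [L] modulo [J]. For [a] in [L],
    [a * c = a - a * l] lies in both [C] and [L], hence in [J]. So [L (c * t)] lies in [J] and [L]
    for every [t], and the idealizer property puts [c * t] in [R]. *)
Lemma lrconductor_comax : exists k l, [/\ K k, L l & k + l = 1].
Proof.
have lL := lconductor_left_ideal subR.
have JL : J `<=` L := subset_trans jacobson_sub_conductor (@conductor_subl _ R).
have [C [lC JC CL [c [l [Cc Ll cl]]]]] := jacobson_complement artT lL JL.
exists c, l; split=> // t; apply: lconductor_idealizer => a La.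
rewrite mulrA; apply: JL; apply: (idealMr (jacobson_ideal T)) => //.
apply: CL; split; first exact: left_idealTM.
have -> : a * c = a - a * l.
  by apply: (addIr (a * l)); rewrite subrK -mulrDr cl mulr1.
by apply: (zsetB zL) => //; apply: lconductorMl.
Qed.

(** [T K] is an ideal of [T] above [Q], so it is [Q] or [T]. If it were [Q], then [K] would lie in
    [L], and so would [1 = k + l]. *)
Lemma setprod_rconductorT : setprod setT K = setT.
Proof.
have [_ _ maxQ] := conductor_maximal.
have iTK : ideal [set: T] (setprod setT K).
  by apply: setprod_ideal => // x t; apply: rconductorMr.
have KTK : K `<=` setprod setT K by move=> x Kx; rewrite -[x]mul1r; apply: setprodM.
have [|TKQ|//] := maxQ _ iTK.
  exact: subset_trans (@conductor_subr _ R) KTK.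
have [k [l [Kk Ll kl]]] := lrconductor_comax.
case: lconductor1; rewrite -kl; apply: (zsetD zL) => //.
by apply: conductor_subl; rewrite -TKQ; apply: KTK.
Qed.

Lemma rconductor_idealizer x : (forall a, K a -> K (x * a)) -> R x.
Proof.
move=> Kx; pose S := [set t | forall a, K a -> K (t * a)].
suff <- : S = R by [].
apply: maximal_subring_adjoin.
- apply: subringP; first by move=> a Ka; rewrite mul1r.
    by move=> u v Su Sv a Ka; rewrite mulrBl; apply: (zsetB zK); [exact: Su|exact: Sv].
  by move=> u v Su Sv a Ka; rewrite -mulrA; apply: Su; apply: Sv.
- by move=> r Rr a Ka; apply: rconductorMl.
- move=> ST; apply: rconductor1.
  have : setprod setT K 1 by rewrite setprod_rconductorT.
  apply: (setprod_sub (X := K) zK) => t a _ Ka.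
  by have : S t by [rewrite ST]; apply.
Qed.

(** For an ideal [I] of [R] above [L], test the ideal [T I K] of [T] against [Q]. If it lies in [Q],
    the idealizer of [K] puts [T I] in [R], so [I = L]. Otherwise [1 = q + a] with [a] in [T I K];
    as [K T I K] lies in [R I R], both parts of [k = k * q + k * a] are in [I], and so is
    [1 = k + l]. *)
Lemma lconductor_maximal : maximal_ideal R L.
Proof.
have iL := lconductor_ideal subR; split=> //.
  by move=> LR; apply: lconductor1; rewrite LR; apply: subring1.
move=> I iI LI; have lI := iI.1; have zI := left_ideal_zmod lI.
have [k [l [Kk Ll kl]]] := lrconductor_comax.
pose A := setprod (setprod setT I) K.
have iA : ideal [set: T] A.
  apply: setprod_ideal => [t x|x t]; last exact: rconductorMr.
  move=> [n [a [b [_ Ib ->]]]]; exists n, (fun i => t * a i), b; split=> //.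
  by rewrite mulr_sumr; apply: eq_bigr => i _; rewrite mulrA.
case: (pselect (A `<=` Q)) => AQ; [left|right].
  rewrite eqEsubset; split=> // x Ix t; apply: rconductor_idealizer => a Ka.
  by apply: conductor_subr; apply: AQ; apply: setprodM => //; apply: setprodM.
have [q [a [Qq Aa qa]]] := maximal_comax subT conductor_maximal iA AQ.
apply: (left_ideal1 lI); rewrite -kl; apply: zsetD => //; last exact: LI.
rewrite -[k]mulr1 -qa mulrDr; apply: zsetD => //.
  by apply: LI; apply: conductor_subl; apply: conductorMl.
move: Aa; apply: (@setprod_sub _ _ _ [set x | I (k * x)]).
  apply/zmod_closedP; split; first by rewrite /= mulr0; apply: zset0.
  by move=> x y Ix Iy; rewrite /= mulrBr; apply: zsetB.
move=> y b Ty Kb /=; move: Ty.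
apply: (@setprod_sub _ _ _ [set y | I (k * (y * b))]).
  apply/zmod_closedP; split; first by rewrite /= mul0r mulr0; apply: zset0.
  by move=> u v Iu Iv; rewrite /= mulrBl mulrBr; apply: zsetB.
move=> t x _ Ix /=; rewrite -mulrA mulrA; apply: (left_idealM lI); first exact: Kk.
by apply: (idealMr iI) => //; apply: rconductor_sub.
Qed.

(** The mirror image of the argument for [L], with the ideal [L I T] and the idealizer of [L]. *)
Lemma rconductor_maximal : maximal_ideal R K.
Proof.
have iK := rconductor_ideal subR; split=> //.
  by move=> KR; apply: rconductor1; rewrite KR; apply: subring1.
move=> I iI KI; have lI := iI.1; have zI := left_ideal_zmod lI.
have [k [l [Kk Ll kl]]] := lrconductor_comax.
pose A := setprod L (setprod I setT).
have iA : ideal [set: T] A.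
  apply: setprod_ideal => [t x|x t]; first exact: lconductorMl.
  move=> [n [a [b [Ia _ ->]]]]; exists n, a, (fun i => b i * t); split=> //.
  by rewrite mulr_suml; apply: eq_bigr => i _; rewrite mulrA.
case: (pselect (A `<=` Q)) => AQ; [left|right].
  rewrite eqEsubset; split=> // x Ix t; apply: lconductor_idealizer => a La.
  by apply: conductor_subl; apply: AQ; apply: setprodM => //; apply: setprodM.
have [q [a [Qq Aa qa]]] := maximal_comax subT conductor_maximal iA AQ.
apply: (left_ideal1 lI); rewrite -kl; apply: zsetD => //; first exact: KI.
rewrite -[l]mul1r -qa mulrDl; apply: zsetD => //.
  by apply: KI; apply: conductor_subr; apply: conductorMr.
move: Aa; apply: (@setprod_sub _ _ _ [set x | I (x * l)]).
  apply/zmod_closedP; split; first by rewrite /= mul0r; apply: zset0.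
  by move=> x y Ix Iy; rewrite /= mulrBl; apply: zsetB.
move=> b y Lb Ty /=; move: Ty.
apply: (@setprod_sub _ _ _ [set y | I (b * y * l)]).
  apply/zmod_closedP; split; first by rewrite /= mulr0 mul0r; apply: zset0.
  by move=> u v Iu Iv; rewrite /= mulrBr mulrBl; apply: zsetB.
move=> x t Ix _ /=; rewrite mulrA -mulrA; apply: (idealMr iI); last exact: Ll.
by apply: (left_idealM lI) => //; apply: lconductor_sub.
Qed.

(** * Correspondence between maximal ideals of [T] and of [R] *)

Lemma setI_subring_ideal P : ideal [set: T] P -> ideal R (P `&` R).
Proof.
move=> iP; have zP := left_ideal_zmod iP.1; have zR := subring_zmod_closed subR.
split; last first.
  move=> r x Rr [Px Rx]; split; last exact: subringM.
  exact: idealMr iP Px _.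
split; first by move=> x [].
- apply/zmod_closedP; split; first by split; apply: zset0.
  by move=> x y [Px Rx] [Py Ry]; split; apply: zsetB.
- move=> r x Rr [Px Rx]; split; last exact: subringM.
  exact: left_idealTM iP.1 _.
Qed.

(* The ideals of [T] and of [R] that do not contain the common ideal [Q]
   correspond to each other; this is the inverse of [P |-> P `&` R]. *)
Definition lift_ideal (P : set T) : set T :=
  [set t | forall q q', Q q -> Q q' -> P (q * t * q')].

Lemma lift_ideal_ideal P : ideal R P -> ideal [set: T] (lift_ideal P).
Proof.
move=> iP; have zP := left_ideal_zmod iP.1.
split; last first.
  move=> t x _ Px q q' Qq Qq'; rewrite mulrA -mulrA.
  by apply: Px => //; apply: conductorMl.
apply/left_idealTP; split; last first.
  move=> t x Px q q' Qq Qq'; rewrite mulrA.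
  by apply: Px => //; apply: conductorMr.
apply/zmod_closedP; split.
  by move=> q q' _ _; rewrite mulr0 mul0r; apply: zset0.
by move=> x y Px Py q q' Qq Qq'; rewrite mulrBr mulrBl; apply: zsetB => //;
  [apply: Px | apply: Py].
Qed.

Lemma lift_ideal_subr P : ideal R P -> P `<=` lift_ideal P `&` R.
Proof.
move=> iP x Px; split; last exact: left_ideal_sub iP.1 _ Px.
move=> q q' Qq Qq'; apply: (idealMr iP); last exact: conductor_sub.
by apply: (left_idealM iP.1) => //; apply: conductor_sub.
Qed.

(** Using [p + q = 1] on both sides, [x = p * x + q * x * p + q * x * q], and the last term is in
    [P] by the definition of the lift. *)
Lemma lift_ideal_setI P : ideal R P ->
  (exists p q, [/\ P p, Q q & p + q = 1]) -> lift_ideal P `&` R = P.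
Proof.
move=> iP [p [q [Pp Qq pq]]]; have zP := left_ideal_zmod iP.1.
rewrite eqEsubset; split; last exact: lift_ideal_subr.
move=> x [Px Rx]; have Rq := conductor_sub Qq.
rewrite -[x]mul1r -pq mulrDl; apply: zsetD => //; first exact: idealMr iP _ _.
rewrite -[q * x]mulr1 -pq mulrDr; apply: zsetD => //; last exact: Px.
by apply: (left_idealM iP.1) => //; apply: subringM.
Qed.

(** Maximality of [Q] gives [q + p = 1], and [p = 1 - q] falls in [R] because [Q] lies in [R]. *)
Lemma conductor_comax P : ideal [set: T] P -> ~ P `<=` Q ->
  exists p q, [/\ (P `&` R) p, Q q & p + q = 1].
Proof.
move=> iP PQ.
have [q [p [Qq Pp qp]]] := maximal_comax subT conductor_maximal iP PQ.
exists p, q; split=> //; last by rewrite addrC.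
split=> //; apply: (zsetDr (subring_zmod_closed subR) (conductor_sub Qq)).
by rewrite qp; apply: subring1.
Qed.

Lemma maximal_not_sub_conductor P :
  maximal_ideal [set: T] P -> P <> Q -> ~ P `<=` Q.
Proof.
move=> mP PQ PsQ; apply: PQ.
exact: maximal_ideal_inj mP conductor_maximal PsQ.
Qed.

Lemma setI_subring_maximal P :
  maximal_ideal [set: T] P -> P <> Q -> maximal_ideal R (P `&` R).
Proof.
move=> mP PQ; have [iP _ maxP] := mP; have iPR := setI_subring_ideal iP.
have [p [q [[Pp Rp] Qq pq]]] := conductor_comax iP (maximal_not_sub_conductor mP PQ).
split=> //.
  move=> PRR; apply: (maximal_ideal1 mP).
  by have : R 1 by [exact: subring1]; rewrite -{1}PRR => -[].
move=> I iI PI; have lI := iI.1; have zI := left_ideal_zmod lI.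
have [||IP|IT] := maxP (lift_ideal I); first exact: lift_ideal_ideal.
- move=> x Px u v Qu Qv; apply: PI; split.
    by apply: (idealMr iP) => //; apply: left_idealTM iP.1 _.
  by rewrite -mulrA; apply: conductor_sub; apply: conductorMr.
- left; rewrite eqEsubset; split=> //.
  by rewrite -[X in _ `<=` X `&` _]IP; apply: lift_ideal_subr.
(* If the lift of [I] is all of [T], then [q * q] is in [I], hence [q = q * p + q * q] and
   [1 = p + q] are too. *)
right; apply: (left_ideal1 lI); rewrite -pq.
apply: zsetD => //; first by apply: PI.
rewrite -[q]mulr1 -pq mulrDr; apply: zsetD => //.
  by apply: (left_idealM lI); [exact: conductor_sub | apply: PI].
have : lift_ideal I 1 by rewrite IT.
by move=> /(_ q q Qq Qq); rewrite mulr1.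
Qed.

Lemma lift_ideal_maximal P : maximal_ideal R P -> ~ Q `<=` P ->
  [/\ maximal_ideal [set: T] (lift_ideal P), lift_ideal P <> Q &
      lift_ideal P `&` R = P].
Proof.
move=> mP QP; have [iP _ maxP] := mP; have iP' := lift_ideal_ideal iP.
have PE : lift_ideal P `&` R = P.
  by apply: lift_ideal_setI => //; apply: (maximal_comax subR mP) => //;
    apply: conductor_ideal.
have R1 := subring1 subR.
split=> //; last first.
  by move=> PQ; apply: QP; rewrite -PE PQ => x Qx; split=> //; apply: conductor_sub.
split=> //.
  by move=> PT; apply: (maximal_ideal1 mP); rewrite -PE PT.
move=> I iI PI.
have [||IP|IR] := maxP (I `&` R); first exact: setI_subring_ideal.
- by rewrite -{1}PE; apply: setSI.
(* Here [Q I Q] lies in both [I] and [R], hence in [P], which places [I] inside the lift of [P]. *)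
- left; rewrite eqEsubset; split=> // x Ix q q' Qq Qq'; rewrite -IP; split.
    by apply: (idealMr iI) => //; apply: left_idealTM iI.1 _.
  by rewrite -mulrA; apply: conductor_sub; apply: conductorMr.
- right; apply: (left_ideal1 iI.1).
  by move: R1; rewrite -{1}IR => -[].
Qed.

(** With [p + q = 1], [p] in [P'] and [q] in [Q], the term [q * x] of [x = p * x + q * x] lies in
    [P] and in [R], so the equal intersections carry it into [P']. *)
Lemma setI_subring_inj P P' :
  maximal_ideal [set: T] P -> maximal_ideal [set: T] P' ->
  P <> Q -> P' <> Q -> P `&` R = P' `&` R -> P = P'.
Proof.
move=> mP mP' PQ P'Q PP'; have [[iP _ _] [iP' _ _]] := (mP, mP').
have [p [q [[P'p Rp] Qq pq]]] :=
  conductor_comax iP' (maximal_not_sub_conductor mP' P'Q).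
apply: (maximal_ideal_inj mP mP') => x Px.
have zP' := left_ideal_zmod iP'.1.
rewrite -[x]mul1r -pq mulrDl; apply: zsetD => //; first exact: idealMr iP' _ _.
suff [] : (P' `&` R) (q * x) by [].
rewrite -PP'; split; first exact: left_idealTM iP.1 _.
by apply: conductor_sub; apply: conductorMr.
Qed.

Lemma Max_maximal_subring :
  Max R = [set L; K] `|` [set P `&` R | P in Max [set: T] `\ Q].
Proof.
rewrite eqEsubset; split=> [P mP|P].
  case: (pselect (Q `<=` P)) => QP; last first.
    have [mP' P'Q PE] := lift_ideal_maximal mP QP.
    by right; exists (lift_ideal P).
  left; have iL := lconductor_ideal subR; have iK := rconductor_ideal subR.
  have [a b La Kb||] := maximal_ideal_prime subR mP iL iK.1.
  - by apply: QP; apply: lrconductorM.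
  - by move/(maximal_ideal_inj lconductor_maximal mP); left.
  - by move/(maximal_ideal_inj rconductor_maximal mP); right.
move=> [[->|->]|[P' [mP' P'Q] <-]].
- exact: lconductor_maximal.
- exact: rconductor_maximal.
- exact: setI_subring_maximal.
Qed.

End MaximalSubring.

Theorem theorem4p5 (T : pzRingType) (R : set T)
    (R_max : maximal_subring R) (R_art : left_artinian R)
    (lT : setprod (lconductor R) setT = setT) :
  let Q := conductor R in
  [/\ fg_left_module R setT,
      fg_right_module R (lconductor R),
      left_artinian [set: T] &
      jacobson R = jacobson [set: T] `&` R \/
      [/\ Max [set: T] Q /\ jacobson [set: T] `<=` jacobson R `&` Q,
          setprod setT (rconductor R) = setT /\ fg_right_module R setT &
          [/\ forall M N : set T, Max [set: T] M -> Max [set: T] N ->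
                M <> N -> M <> Q -> N <> Q -> M `&` R <> N `&` R,
              Max R = [set lconductor R; rconductor R] `|`
                      [set P `&` R | P in Max [set: T] `\ Q] &
              exists n : nat,
                Max [set: T] #= `I_n /\ Max R #= `I_n.+1]]].
Proof.
have [subR _ _] := R_max.
have fgT := fg_left_module_lconductor lT.
have artT := fg_left_artinian subR R_art fgT.
have mQ := conductor_maximal R_max artT lT.
have rT := setprod_rconductorT R_max artT lT.
move=> Q; split=> //; first exact: fg_right_module_lconductor.
have JQ := jacobson_sub_conductor R_max lT.
have MaxR := Max_maximal_subring R_max artT lT.
right; split.
- split=> // x Jx; split; last exact: JQ.
  by apply: sub_jacobson Jx => // y /JQ; apply: conductor_sub.
- by split=> //; apply: fg_right_module_rconductor.
have injR := setI_subring_inj R_max artT lT.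
split=> //; first by move=> M N mM mN MN MQ NQ /(injR _ _ mM mN MQ NQ).
have /finite_setP[n cardT] := left_artinian_finite_Max (subringT T) artT.
exists n; split=> //.
(* The count rests on a bijection from the maximal ideals of [T] to those of [R] other than [L]: [Q]
   goes to [K], and every other [P] to its intersection with [R]. *)
pose g P := if pselect (P = Q) then rconductor R else P `&` R.
have gQ : g Q = rconductor R by rewrite /g; case: pselect.
have gP P : P <> Q -> g P = P `&` R by rewrite /g; case: pselect.
(* Separates [L] and [K], which contain [Q], from all the intersections [P] with [R], which do
   not. *)
have Qn X P : Max [set: T] P -> P <> Q -> Q `<=` X -> X <> P `&` R.
  move=> mP PQ QX E; apply: PQ; apply/esym/(maximal_ideal_inj mQ mP).
  by move=> x /QX; rewrite E => -[].
have QL := @conductor_subl T R; have QK := @conductor_subr T R.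
have LK : lconductor R <> rconductor R.
  move=> E; apply: (lconductor1 R_max).
  have [k [l [Kk Ll <-]]] := lrconductor_comax R_max artT lT.
  by apply: (zsetD (lconductor_zmod subR)) => //; rewrite E.
apply/eq_cardSP; exists (lconductor R); first by rewrite MaxR; left; left.
have -> : Max R `\ lconductor R = [set g P | P in Max [set: T]].
  rewrite MaxR eqEsubset; split=> [X [[[->|->]|[P [mP PQ] <-]] XL]|_ [P mP <-]].
  - by case: XL.
  - by exists Q; [exact: mQ | exact: gQ].
  - by exists P => //; rewrite gP.
  case: (pselect (P = Q)) => [->|PQ]; rewrite ?gQ ?gP //.
    by split; [left; right | move/esym].
  split; first by right; exists P.
  by move/esym; apply: Qn.
rewrite (card_eql (inj_card_eq _)) // => P P'; rewrite !inE => mP mP'.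
case: (pselect (P = Q)) => [->|PQ]; case: (pselect (P' = Q)) => [->|P'Q] //.
- by rewrite gQ gP // => /Qn; case.
- by rewrite gQ gP // => /esym/Qn; case.
- by rewrite !gP //; apply: injR.
Qed.
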